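(* Consider the formal differential parametrization of the Euler-Bernoulli beam whose sequence of coefficients of $z^2$ in the polynomials $\alpha_{2k}(z)$ is $(c_{0,0},c_{1,0},c_{2,0},\ldots)=(\tfrac12,0,0,\ldots)$. Then formally $y(t)=\partial_z^2 w(0,t)$, i.e. the parametrizing output is the bending moment at the clamped boundary, and the parametrization is $$w(z,t)=\sum_{k=0}^{\infty}\left((-1)^k\frac{1}{(4k+2)!}z^{4k+2}+\sum_{i=0}^{k-1}(-1)^i\frac{3}{(4i+3)!}\,\eta_{k-i}\,z^{4i+3}\right)y^{(2k)}(t),$$ $$u(t)=\sum_{k=0}^{\infty}\tfrac12\,\mu_k\,y^{(2k)}(t),$$ where the sequences $(\eta_k)_{k\in\mathbb{N}}$ and $(\mu_k)_{k\in\mathbb{N}}$ are defined recursively by $\eta_0=0$, $\mu_0=2$ and, for $k\ge 1$, $$\eta_k=-\frac{(-1)^k}{3(4k-1)!}-\sum_{i=1}^{k}\eta_{k-i}\frac{(-1)^i}{(4i)!},\qquad \mu_k=\frac{4^k}{(4k)!}-\sum_{i=1}^{k}\mu_{k-i}\frac{(-1)^i}{(4i)!}.$$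
   Context: $\mathbb{N}$ includes $0$; $'$ denotes differentiation with respect to $z$; $y^{(m)}$ is the $m$-th time derivative of $y$. The Euler-Bernoulli beam is the system $\partial_t^2 w(z,t)=-\partial_z^4 w(z,t)$, $0\le z\le 1$, $t\ge 0$, with boundary conditions $w(0,t)=0$, $\partial_z w(0,t)=0$, $\partial_z^2 w(1,t)=u(t)$, $\partial_z^3 w(1,t)=0$, where $u(t)$ is the input. A formal differential parametrization (with time derivatives of even order only) consists of functions $\alpha_{2k}:[0,1]\to\mathbb{R}$ and real numbers $\beta_{2k}$, $k\in\mathbb{N}$, such that the series $w(z,t)=\sum_{k\ge 0}\alpha_{2k}(z)y^{(2k)}(t)$ and $u(t)=\sum_{k\ge 0}\beta_{2k}y^{(2k)}(t)$ formally (after interchanging differentiation and summation, without regard to convergence) satisfy the PDE and the boundary conditions for arbitrary smooth functions $y(t)$. This means that the factors of all time derivatives of $y$ vanish, i.e. $$\alpha_0''''(z)=0,\qquad \alpha_{2k}''''(z)=-\alpha_{2(k-1)}(z)\ \ (k\ge 1),$$ $$\alpha_{2k}(0)=0,\quad \alpha_{2k}'(0)=0,\quad \alpha_{2k}''(1)=\beta_{2k},\quad \alpha_{2k}'''(1)=0\ \ (k\ge 0).$$ The functions $\alpha_{2k}$ are then polynomials of the form $\alpha_{2k}(z)=\sum_{i=0}^{k}\left(c_{k,i}z^{4i+2}+d_{k,i}z^{4i+3}\right)$ with real coefficients $c_{k,i},d_{k,i}$ and $d_{k,k}=0$. For every real sequence $(c_{k,0})_{k\in\mathbb{N}}$ there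 is exactly one formal differential parametrization of this form having these numbers as coefficients of $z^2$ in the $\alpha_{2k}$. The series identities are to be understood formally, i.e. as identities for the coefficients $\alpha_{2k}(z)$ and $\beta_{2k}$; in particular $y(t)=\partial_z^2 w(0,t)$ means $\alpha_0''(0)=1$ and $\alpha_{2k}''(0)=0$ for $k\ge 1$. *)

(* Defs.v *)
From mathcomp Require Import all_boot all_order all_algebra.
From mathcomp Require Import all_classical all_reals all_analysis.
Set Implicit Arguments.
Unset Strict Implicit.
Unset Printing Implicit Defensive.
Import Order.TTheory GRing.Theory Num.Theory.
Import numFieldNormedType.Exports.
Local Open Scope classical_set_scope.
Local Open Scope ring_scope.

(* Functions on [0, 1] are represented by functions R -> R of which only the
   values on [0, 1] matter.  Accordingly, the difference quotient is taken
   within [0, 1]: derivatives at 0 and 1 are one-sided. *)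
Definition dquot01 (R : realType) (f : R -> R) (z : R) :=
  (fun x : R => (f x - f z) / (x - z)) @ within `[0, 1] (dnbhs z).

Definition derivable01 (R : realType) (f : R -> R) : Prop :=
  forall z : R, z \in `[0, 1] -> cvg (dquot01 f z).

(* Meaningful at the points of [0, 1] where f is differentiable. *)
Definition D01 (R : realType) (f : R -> R) : R -> R :=
  fun z => lim (dquot01 f z).

Definition D01n (R : realType) (n : nat) (f : R -> R) : R -> R :=
  iter n (@D01 R) f.

Definition derivable01n (R : realType) (n : nat) (f : R -> R) : Prop :=
  forall m : nat, (m < n)%N -> derivable01 (D01n m f).

(* alpha k and beta k are the factors of y^(2k), i.e. alpha_{2k}, beta_{2k}:
   w(z,t) = sum_k alpha k z * y^(2k)(t), u(t) = sum_k beta k * y^(2k)(t).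
   The fields say that the factor of each y^(2k) vanishes in the beam equation
   w_tt = - w_zzzz and in the boundary conditions w(0,t) = w_z(0,t) = 0,
   w_zz(1,t) = u(t), w_zzz(1,t) = 0. *)
Record formal_diff_param (R : realType)
    (alpha : nat -> R -> R) (beta : nat -> R) : Prop := FormalDiffParam {
  fdp_derivable : forall k, derivable01n 4 (alpha k);
  fdp_pde0 : forall z : R, z \in `[0, 1] -> D01n 4 (alpha 0%N) z = 0;
  fdp_pdeS : forall k (z : R), z \in `[0, 1] ->
    D01n 4 (alpha k.+1) z = - alpha k z;
  fdp_clamped : forall k, alpha k 0 = 0;
  fdp_clamped_slope : forall k, D01n 1 (alpha k) 0 = 0;
  fdp_input : forall k, D01n 2 (alpha k) 1 = beta k;
  fdp_shear : forall k, D01n 3 (alpha k) 1 = 0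
}.

(* On [0, 1],
   alpha_{2k}(z) = sum_{i=0}^k (c_{k,i} z^(4i+2) + d_{k,i} z^(4i+3)) with
   d_{k,k} = 0, and the coefficients c_{k,0} of z^2 form the sequence c0. *)
Definition has_z2_coefs (R : realType)
    (alpha : nat -> R -> R) (c0 : nat -> R) : Prop :=
  exists c d : nat -> nat -> R,
    [/\ forall k, d k k = 0,
        forall k (z : R), z \in `[0, 1] ->
          alpha k z = \sum_(i < k.+1) (c k i * z ^+ (4 * i + 2)
                                       + d k i * z ^+ (4 * i + 3))
      & forall k, c k 0%N = c0 k].

(* y(t) = w_zz(0,t), read coefficientwise. *)
Definition output_is_clamped_moment (R : realType)
    (alpha : nat -> R -> R) : Prop :=
  D01n 2 (alpha 0%N) 0 = 1 /\ forall k, (0 < k)%N -> D01n 2 (alpha k) 0 = 0.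

(* Main.v *)
Require Import Defs.
From mathcomp Require Import all_boot all_order all_algebra.
From mathcomp Require Import all_classical all_reals all_analysis.
From mathcomp Require Import ring lra zify.
Import Order.TTheory GRing.Theory Num.Theory.
Import numFieldNormedType.Exports.
Local Open Scope classical_set_scope.
Local Open Scope ring_scope.

(** Two solutions with the same z^2-coefficients coincide: once alpha_{2(k-1)}
    is known, the fourth derivative and the clamped end determine alpha_{2k} up
    to a multiple of z^3, and the shear condition at 1 fixes that multiple.  So
    it suffices to check that the stated polynomials solve the equations.  With
    generating series in x (the index k corresponding to x^k), the shear
    condition is the recursion of eta, i.e. 3 E C = - S3 with E the series of eta,
    C = sum (-1)^i x^i / (4i)! and S3 = sum_{i >= 1} (-1)^i x^i / (4i-1)!.  The
    input series is B = C + 3 S1 E with S1 = sum (-1)^i x^i / (4i+1)!, hence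
    B C = C^2 - S1 S3.  For x = - s^4 the latter is (1 + cosh s cos s) / 2, so
    2 B satisfies the recursion of mu; coefficientwise this is an identity for
    sums of binomial coefficients over residue classes modulo 4. *)

(** * Differentiation within [0, 1] of functions that agree there with a polynomial *)

(** Properness makes limits of difference quotients unique, so that [D01] can be computed. From the
    left half of the interval a short step to the right stays in [0, 1], from the right half a step
    to the left. *)
Lemma dnbhs01_proper (R : realType) (z : R) :
  z \in `[0, 1] -> ProperFilter (within `[0, 1] (dnbhs z)).
Proof.
rewrite in_itv /= => /andP[z0 z1].
apply: Build_ProperFilter => /=.
rewrite /within /= => /nbhs_ballP[e /= e0 He].
have [d [d0 [de d2]]] : exists d : R, 0 < d /\ d < e /\ d <= 1 / 2.
  have [h|h] := ltP e 1.
    by exists (e / 2); lra.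
  by exists (1 / 2); lra.
have [h|h] := leP z (1 / 2).
  apply: (He (z + d)); rewrite /ball/= ?in_itv /=.
  - by rewrite opprD addrA subrr sub0r normrN gtr0_norm.
  - by apply/eqP; lra.
  - by apply/andP; split; lra.
apply: (He (z - d)); rewrite /ball/= ?in_itv /=.
- by rewrite opprB addrC subrK gtr0_norm.
- by apply/eqP; lra.
- by apply/andP; split; lra.
Qed.

(** Writing p - p(z) = q (X - z), the difference quotient is q off z; q is continuous and q(z) =
    p'(z). *)
Lemma dquot01_poly (R : realType) (f : R -> R) (p : {poly R}) (z : R) :
  {in `[0, 1], forall x, f x = p.[x]} -> z \in `[0, 1] ->
  dquot01 f z --> p^`().[z].
Proof.
move=> fp z01.
have /factor_theorem[q pq] : root (p - p.[z]%:P) z.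
  by rewrite rootE !hornerE subrr.
have -> : p^`().[z] = q.[z].
  have -> : p = q * ('X - z%:P) + p.[z]%:P by rewrite -pq subrK.
  by rewrite !poly.derivE !hornerE; ring.
have qz : q.[x] @[x --> within `[0, 1] (dnbhs z)] --> q.[z].
  apply: cvg_within_filter; apply: cvg_within_filter.
  exact: continuous_horner.
apply: cvg_trans qz; apply: near_eq_cvg.
near=> x.
have xz : x != z by near: x; apply: cvg_within; exact: withinT.
have x01 : x \in `[0, 1] by near: x; exact: withinT.
have : (p - p.[z]%:P).[x] = q.[x] * (x - z) by rewrite pq !hornerE.
rewrite !hornerE => e.
by rewrite !fp// e mulfK// subr_eq0.
Unshelve. all: by end_near. Qed.


Lemma derivable01_poly (R : realType) (f : R -> R) (p : {poly R}) :
  {in `[0, 1], forall x, f x = p.[x]} -> derivable01 f.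
Proof.
by move=> fp z z01; apply/cvg_ex; exists p^`().[z]; exact: dquot01_poly.
Qed.

Lemma D01n_poly (R : realType) (f : R -> R) (p : {poly R}) n :
  {in `[0, 1], forall x, f x = p.[x]} ->
  {in `[0, 1], forall x, D01n n f x = p^`(n).[x]}.
Proof.
move=> fp; elim: n => [//|n IH] z z01; rewrite derivnS.
have z01p := dnbhs01_proper _ _ z01.
by apply: cvg_lim => //; exact: dquot01_poly.
Qed.

Lemma derivable01n_poly (R : realType) (f : R -> R) (p : {poly R}) n :
  {in `[0, 1], forall x, f x = p.[x]} -> derivable01n n f.
Proof.
by move=> fp m _; apply: (derivable01_poly _ _ p^`(m)); exact: D01n_poly.
Qed.

Lemma poly_eq01 (R : realType) (p q : {poly R}) :
  {in `[0, 1], forall x, p.[x] = q.[x]} -> p = q.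
Proof.
move=> pq; apply/eqP; rewrite -subr_eq0; apply/eqP.
(* The points 1/(i+1) lie in [0, 1], are distinct, and as many as the size of p - q, hence more than
   its degree if it is nonzero. *)
apply: (@roots_geq_poly_eq0 _ _
  [seq i.+1%:R^-1 | i <- iota 0 (size (p - q))]); last by rewrite size_map size_iota.
  apply/allP => _ /mapP[i _ ->]; rewrite rootE !hornerE pq ?subrr//.
  by rewrite in_itv /= invr_ge0 ler0n invf_le1 ?ltr0n// ler1n.
rewrite map_inj_uniq ?iota_uniq// => i j /invr_inj/eqP.
by rewrite eqr_nat => /eqP[].
Qed.

(** * Cauchy products of coefficient sequences, and binomial sums modulo 4 *)

Lemma sum_conv_rec (R : comNzRingType) (u c : nat -> R) (a : R) k :
  c 0%N = 1 -> u k = a - \sum_(1 <= i < k.+1) u (k - i)%N * c i ->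
  \sum_(i < k.+1) u (k - i)%N * c i = a.
Proof.
move=> c0 uk; rewrite big_ord_recl /= subn0 c0 mulr1 uk.
by rewrite big_add1 big_mkord /= subrK.
Qed.

(** A power series with constant term 1 can be cancelled: the term i = 0 isolates [u k], and the
    others are settled by strong induction. *)
Lemma sum_conv_inj (R : comNzRingType) (u v c : nat -> R) :
  c 0%N = 1 ->
  (forall k, \sum_(i < k.+1) u (k - i)%N * c i =
             \sum_(i < k.+1) v (k - i)%N * c i) -> u =1 v.
Proof.
move=> c0 uv k; elim/ltn_ind: k => k IH; have := uv k.
rewrite !big_ord_recl /= subn0 c0 !mulr1.
rewrite (eq_bigr (fun i : 'I_k => v (k - bump 0 i)%N * c (bump 0 i))); first exact: addIr.
by move=> [i ik] _ /=; rewrite IH// /bump /=; lia.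
Qed.

(** By Pascal's rule, the operator 1 + shift, iterated n times, expands binomially. *)
Lemma sum_bin_iter (R : comNzRingType) (g : nat -> R) n :
  \sum_(j < n.+1) 'C(n, j)%:R * g j =
  iter n (fun h j => h j + h j.+1) g 0%N.
Proof.
elim: n g => [|n IH] g; first by rewrite big_ord1 bin0 mul1r.
rewrite iterSr -IH big_ord_recl /= bin0.
under eq_bigr => i _ do rewrite /bump /= binS natrD mulrDl.
rewrite big_split /= addrA.
under [RHS]eq_bigr => i _ do rewrite mulrDr.
rewrite big_split /=; congr (_ + _).
rewrite [RHS]big_ord_recl /= bin0; congr (_ + _).
by rewrite big_ord_recr /= bin_small// mul0r addr0.
Qed.

(* The weight on the left is 4-periodic and is carried by (1 + shift)^4 to [s],
   which is an eigenvector of (1 + shift)^4 for the eigenvalue -4. *)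
Lemma sum_bin_mod4 (R : comNzRingType) k :
  \sum_(j < (4 * k.+1).+1) 'C(4 * k.+1, j)%:R *
    ((j %% 4 == 0)%N%:R - (j %% 4 == 1)%N%:R) = (- 4) ^+ k * (- 2) :> R.
Proof.
pose g (j : nat) : R := (j %% 4 == 0)%N%:R - (j %% 4 == 1)%N%:R.
pose s (j : nat) : R := if (j %% 4)%N \in [:: 0; 3]%N then - 2 else 2.
have c4 (j : nat) : [\/ j %% 4 = 0, j %% 4 = 1, j %% 4 = 2 | j %% 4 = 3]%N.
  by case: (j %% 4)%N (ltn_pmod j (isT : 0 < 4)%N) => [|[|[|[|]]]]// _;
    [apply: Or41|apply: Or42|apply: Or43|apply: Or44].
have mS (j : nat) : (j.+1 %% 4 = (j %% 4).+1 %% 4)%N by rewrite -addn1 -modnDml addn1.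
have mSS (j : nat) : (j.+2 %% 4 = (j %% 4).+2 %% 4)%N by rewrite -addn2 -modnDml addn2.
have mSSS (j : nat) : (j.+3 %% 4 = (j %% 4).+3 %% 4)%N by rewrite -addn3 -modnDml addn3.
have m4 (j : nat) : (j.+4 %% 4 = j %% 4)%N by rewrite -addn4 modnDr.
have step m : iter (4 * m.+1) (fun h j => h j + h j.+1) g =
              (fun j => (- 4) ^+ m * s j).
  elim: m => [|m IH]; apply/funext => j.
    rewrite muln1 /= expr0 mul1r /g /s m4 mSSS mSS mS.
    case: (c4 j) => -> /=; ring.
  rewrite (_ : 4 * m.+2 = 4 + 4 * m.+1)%N; last by lia.
  rewrite iterD IH /= exprS /s m4 mSSS mSS mS.
  case: (c4 j) => -> /=; ring.
by rewrite (sum_bin_iter _ g) step /s.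
Qed.

Lemma sum_blocks4 (V : nmodType) (F : nat -> V) k :
  \sum_(j < (4 * k).+1) F j =
  \sum_(i < k) (F (4 * i)%N + F (4 * i + 1)%N + F (4 * i + 2)%N + F (4 * i + 3)%N)
  + F (4 * k)%N.
Proof.
elim: k => [|k IH]; first by rewrite muln0 big_ord1 big_ord0 add0r.
rewrite (_ : 4 * k.+1 = (4 * k).+4)%N; last by lia.
do 4! rewrite [in LHS]big_ord_recr /=.
by rewrite IH [in RHS]big_ord_recr /= addn1 addn2 addn3 !addrA.
Qed.

(** Up to the sign (-1)^k, this is the coefficient of x^k in 2 (C^2 - S1 S3). Multiplied by (4k)!,
    the two sums run over the binomial coefficients with lower index 0 and 1 modulo 4. *)
Lemma sum_inv_fact_mod4 (R : numFieldType) k : (0 < k)%N ->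
  2 * (\sum_(i < k.+1) ((4 * i)`!%:R * (4 * (k - i))`!%:R)^-1
       - \sum_(i < k) ((4 * i + 1)`!%:R * (4 * (k - i) - 1)`!%:R)^-1)
  = (- 4) ^+ k / (4 * k)`!%:R :> R.
Proof.
case: k => [//|k] _.
have fn0 n : n`!%:R != 0 :> R by rewrite pnatr_eq0 -lt0n fact_gt0.
have binE n j : (j <= n)%N ->
    (j`!%:R * (n - j)`!%:R)^-1 = 'C(n, j)%:R / n`!%:R :> R.
  by move=> jn; rewrite -(bin_fact jn) !natrM; field; rewrite !fn0 pnatr_eq0 -lt0n bin_gt0 jn.
pose g (j : nat) : R := (j %% 4 == 0)%N%:R - (j %% 4 == 1)%N%:R.
have := sum_bin_mod4 R k; rewrite (sum_blocks4 _ (fun j => 'C(4 * k.+1, j)%:R * g j)).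
have g0 i : g (4 * i)%N = 1 by rewrite /g modnMr subr0.
have g1 i : g (4 * i + 1)%N = - 1 by rewrite /g mulnC modnMDl sub0r.
have g2 i : g (4 * i + 2)%N = 0 by rewrite /g mulnC modnMDl subr0.
have g3 i : g (4 * i + 3)%N = 0 by rewrite /g mulnC modnMDl subr0.
under eq_bigr => i _ do rewrite g0 g1 g2 g3 !mulr0 !addr0 mulr1 mulrN1.
rewrite sumrB g0 mulr1 addrAC => e.
have -> : \sum_(i < k.+2) ((4 * i)`!%:R * (4 * (k.+1 - i))`!%:R)^-1 =
    (\sum_(i < k.+2) 'C(4 * k.+1, 4 * i)%:R) / (4 * k.+1)`!%:R :> R.
  rewrite mulr_suml; apply: eq_bigr => -[i ik] _ /=.
  by rewrite mulnBr binE// leq_mul2l.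
have -> : \sum_(i < k.+1) ((4 * i + 1)`!%:R * (4 * (k.+1 - i) - 1)`!%:R)^-1 =
    (\sum_(i < k.+1) 'C(4 * k.+1, 4 * i + 1)%:R) / (4 * k.+1)`!%:R :> R.
  rewrite mulr_suml; apply: eq_bigr => -[i ik] _ /=.
  by rewrite mulnBr -subnDA binE//; lia.
rewrite -mulrBl big_ord_recr /= e exprS; field.
exact: fn0.
Qed.

(** Associativity of the product of power series, (s e) c = s (e c), read off from polynomials
    truncated after degree k. *)
Lemma sum_conv_mulA (R : comNzRingType) (s e c d : nat -> R) k :
  (forall j, \sum_(i < j.+1) e (j - i)%N * c i = d j) ->
  \sum_(i < k.+1) (\sum_(j < (k - i).+1) s j * e (k - i - j)%N) * c i =
  \sum_(i < k.+1) s i * d (k - i)%N.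
Proof.
move=> ecd; pose P (u : nat -> R) := \poly_(i < k.+1) u i.
have Pc u j : (j <= k)%N -> (P u)`_j = u j by move=> jk; rewrite coef_poly ltnS jk.
transitivity (P s * P e * P c)`_k.
  rewrite coefMr; apply: eq_bigr => -[i ik] _ /=.
  rewrite (Pc c)// coefM; congr (_ * _); apply: eq_bigr => -[j jk] _ /=.
  by rewrite !Pc//; lia.
rewrite -mulrA coefM; apply: eq_bigr => -[i ik] _ /=.
rewrite Pc// -ecd coefMr; congr (_ * _); apply: eq_bigr => -[j jk] _ /=.
by rewrite !Pc//; lia.
Qed.

(** * The series of eta and mu *)

Section Beam.
Variables (R : realType) (eta mu : nat -> R).
Hypotheses (eta0 : eta 0%N = 0)
  (etaS : forall k : nat, (0 < k)%N ->
     eta k = - ((-1) ^+ k / (3 * ((4 * k - 1)`!)%:R))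
             - \sum_(1 <= i < k.+1) eta (k - i)%N * ((-1) ^+ i / ((4 * i)`!)%:R))
  (mu0 : mu 0%N = 2)
  (muS : forall k : nat, (0 < k)%N ->
     mu k = 4 ^+ k / ((4 * k)`!)%:R
            - \sum_(1 <= i < k.+1) mu (k - i)%N * ((-1) ^+ i / ((4 * i)`!)%:R)).

Let c0 : (-1) ^+ 0 / (4 * 0)`!%:R = 1 :> R. Proof. by rewrite muln0 divr1. Qed.

Let fact_neq0 n : n`!%:R != 0 :> R.
Proof. by rewrite pnatr_eq0 -lt0n fact_gt0. Qed.

(** This is 3 E C = - S3. The case k = 0 is separate because there the truncated [4 * k - 1] is 0
    and the formula would give -1/3. *)
Lemma eta_conv k : \sum_(i < k.+1) eta (k - i)%N * ((-1) ^+ i / (4 * i)`!%:R) =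
  if k == 0%N then 0 else - ((-1) ^+ k / (3 * (4 * k - 1)`!%:R)).
Proof.
case: k => [|k]; first by rewrite big_ord1 subn0 eta0 mul0r.
by apply: (sum_conv_rec _ eta (fun i => (-1) ^+ i / (4 * i)`!%:R)) => //; exact: etaS.
Qed.

Lemma mu_half k : (-1) ^+ k / (4 * k)`!%:R
  + 3 * \sum_(i < k.+1) (-1) ^+ i / (4 * i + 1)`!%:R * eta (k - i)%N = 1 / 2 * mu k.
Proof.
pose c i : R := (-1) ^+ i / (4 * i)`!%:R.
pose s i : R := (-1) ^+ i / (4 * i + 1)`!%:R.
pose v k : R := 2 * (c k + 3 * \sum_(i < k.+1) s i * eta (k - i)%N).
suff -> : mu k = v k by rewrite /v mulrA divfK ?mul1r.
(* It is enough to compare the products with C: for mu the recursion gives it, for 2 B it is 2 (C^2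
   + 3 S1 E C). *)
move: k; apply: (sum_conv_inj _ _ _ c c0) => k.
transitivity (if k == 0%N then 2 else 4 ^+ k / (4 * k)`!%:R : R).
  case: k => [|k]; first by rewrite big_ord1 subn0 mu0 (c0 : c 0%N = 1) mulr1.
  by apply: (sum_conv_rec _ mu c) => //; exact: muS.
transitivity (2 * (\sum_(i < k.+1) c (k - i)%N * c i + 3 * \sum_(i < k.+1)
    (\sum_(j < (k - i).+1) s j * eta (k - i - j)%N) * c i)); last first.
  rewrite mulr_sumr -big_split mulr_sumr; apply: eq_bigr => i _ /=.
  by rewrite /v; ring.
rewrite (sum_conv_mulA _ _ _ _ _ _ eta_conv).
case: k => [|k] /=; first by rewrite !big_ord1 !mulr0 addr0 subn0 (c0 : c 0%N = 1) !mulr1.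
(* The last term carries the constant coefficient of E C, which is 0. *)
rewrite [X in _ + 3 * X]big_ord_recr /= subnn mulr0 addr0.
have sgn i : (i <= k.+1)%N -> (-1) ^+ (k.+1 - i) * (-1) ^+ i = (-1) ^+ k.+1 :> R.
  by move=> ik; rewrite -exprD subnK.
rewrite (_ : \sum_(i < k.+2) _ = (-1) ^+ k.+1 *
    \sum_(i < k.+2) ((4 * i)`!%:R * (4 * (k.+1 - i))`!%:R)^-1); last first.
  rewrite mulr_sumr; apply: eq_bigr => -[i ik] _ /=.
  by rewrite /c -(sgn i)//; field; rewrite !fact_neq0.
rewrite (_ : 3 * _ = - ((-1) ^+ k.+1 *
    \sum_(i < k.+1) ((4 * i + 1)`!%:R * (4 * (k.+1 - i) - 1)`!%:R)^-1)); last first.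
  rewrite -mulrN -sumrN !mulr_sumr; apply: eq_bigr => -[i ik] _ /=.
  rewrite (_ : (k.+1 - i == 0)%N = false); last by lia.
  rewrite /s -(sgn i); last by lia.
  by field; rewrite !fact_neq0.
rewrite -mulrBr mulrCA sum_inv_fact_mod4// mulrA -exprMn.
by congr (_ ^+ _ / _); ring.
Qed.

(** * The candidate polynomials and their equations *)

(* Divided powers, so that differentiation just lowers the index. *)
Definition monof n : {poly R} := (n`!%:R)^-1 *: 'X^n.

Lemma derivn_monof m n : (monof (m + n))^`(m) = monof n.
Proof.
rewrite /monof derivnZ derivnXn addKn -scalerMnr scalerMnl.
congr (_ *: _); rewrite -mulr_natr.
have e : ((m + n) ^_ m * n`! = (m + n)`!)%N by rewrite -{2}(addKn m n) ffact_fact ?leq_addr.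
by rewrite -e natrM; field; rewrite fact_neq0 pnatr_eq0 -lt0n ffact_gt0 leq_addr.
Qed.

Lemma derivn_monof_small m n : (n < m)%N -> (monof n)^`(m) = 0.
Proof. by move=> nm; rewrite /monof derivnZ derivnXn ffact_small// mulr0n scaler0. Qed.

Lemma horner_monof n x : (monof n).[x] = x ^+ n / n`!%:R.
Proof. by rewrite /monof !hornerE mulrC. Qed.

(** The term i = k vanishes because eta_0 = 0; it is kept so that the boundary values at 1 become
    full convolutions with eta. *)
Definition wpoly k : {poly R} := (-1) ^+ k *: monof (4 * k + 2)
  + \sum_(i < k.+1) ((-1) ^+ i * 3 * eta (k - i)%N) *: monof (4 * i + 3).

Lemma derivn_wpoly n k : (wpoly k)^`(n) = (-1) ^+ k *: (monof (4 * k + 2))^`(n)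
  + \sum_(i < k.+1) ((-1) ^+ i * 3 * eta (k - i)%N) *: (monof (4 * i + 3))^`(n).
Proof.
rewrite /wpoly derivnD derivnZ; congr (_ + _).
by rewrite raddf_sum; apply: eq_bigr => i _; rewrite -derivnZ.
Qed.

Lemma wpoly0_pde : (wpoly 0)^`(4) = 0.
Proof.
by rewrite derivn_wpoly big_ord1 !derivn_monof_small// !scaler0 addr0.
Qed.

Lemma wpolyS_pde k : (wpoly k.+1)^`(4) = - wpoly k.
Proof.
(* Four derivatives kill the z^3 term and lower i by one in the others. *)
rewrite derivn_wpoly big_ord_recl (derivn_monof_small 4 (4 * @ord0 k.+1 + 3))// scaler0 add0r.
rewrite (_ : 4 * k.+1 + 2 = 4 + (4 * k + 2))%N; last by lia.
rewrite derivn_monof exprS mulN1r scaleNr opprD; congr (_ + _).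
rewrite -sumrN; apply: eq_bigr => i _; rewrite lift0 subSS.
rewrite (_ : 4 * i.+1 + 3 = 4 + (4 * i + 3))%N; last by lia.
by rewrite derivn_monof exprS mulN1r !mulNr scaleNr.
Qed.

Lemma wpoly_low k j : (j < 3)%N ->
  (wpoly k)`_j = if (k == 0%N) && (j == 2) then 1 / 2 else 0.
Proof.
move=> j3; rewrite /wpoly coefD coef_sum big1 => [|i _]; last first.
  by rewrite !coefZ coefXn (_ : (j == _) = false) ?mulr0//; lia.
rewrite addr0 !coefZ coefXn.
case: k => [|k] /=.
  by case: eqP => _; rewrite !(mulr0, mul1r, mulr1).
by rewrite (_ : (j == _) = false) ?mulr0//; lia.
Qed.

Lemma wpoly_shear k : (wpoly k)^`(3).[1] = 0.
Proof.
rewrite derivn_wpoly hornerD horner_sum.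
under eq_bigr => i _.
  rewrite addnC derivn_monof hornerZ horner_monof expr1n.
  rewrite (_ : _ * _ = 3 * (eta (k - i)%N * ((-1) ^+ i / (4 * i)`!%:R))); last by ring.
  over.
(* For k = 0 the leading monomial is z^2/2, which three derivatives kill; for k > 0 it contributes
   (-1)^k/(4k-1)! and cancels the convolution. *)
rewrite -mulr_sumr eta_conv; have [->|k0] := eqVneq k 0%N.
  by rewrite derivn_monof_small// scaler0 horner0 mulr0 addr0.
rewrite (_ : 4 * k + 2 = 3 + (4 * k - 1))%N; last by lia.
rewrite derivn_monof hornerZ horner_monof expr1n; field.
exact: fact_neq0.
Qed.

Lemma wpoly_input k : (wpoly k)^`(2).[1] = 1 / 2 * mu k.
Proof.
rewrite -mu_half derivn_wpoly hornerD horner_sum addnC derivn_monof.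
rewrite hornerZ horner_monof expr1n mul1r mulr_sumr; congr (_ + _).
apply: eq_bigr => i _.
rewrite (_ : 4 * i + 3 = 2 + (4 * i + 1))%N; last by lia.
by rewrite derivn_monof hornerZ horner_monof expr1n; ring.
Qed.

Lemma horner_wpoly k z : (wpoly k).[z] =
  (-1) ^+ k * (1 / (4 * k + 2)`!%:R) * z ^+ (4 * k + 2)
  + \sum_(0 <= i < k) (-1) ^+ i * (3 / (4 * i + 3)`!%:R)
                       * eta (k - i)%N * z ^+ (4 * i + 3).
Proof.
rewrite /wpoly hornerD horner_sum hornerZ horner_monof; congr (_ + _); first by ring.
rewrite big_ord_recr /= subnn eta0 mulr0 scale0r horner0 addr0 big_mkord.
by apply: eq_bigr => i _; rewrite hornerZ horner_monof; ring.
Qed.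

(** * Uniqueness, and passage from functions on [0, 1] to polynomials *)

(** Inductively the fourth derivatives agree, so the difference has degree at most 3; the low
    coefficients leave a multiple of z^3, whose third derivative is constant and vanishes at 1. *)
Lemma wpoly_unique (P : nat -> {poly R}) :
  (P 0)^`(4) = 0 -> (forall k, (P k.+1)^`(4) = - P k) ->
  (forall k j, (j < 3)%N -> (P k)`_j = (wpoly k)`_j) ->
  (forall k, (P k)^`(3).[1] = 0) -> P =1 wpoly.
Proof.
move=> P0 PS low shear.
have base k : (P k)^`(4) = (wpoly k)^`(4) -> P k = wpoly k.
  move=> P4; pose d := P k - wpoly k.
  have d_high j : (4 <= j)%N -> d`_j = 0.
    move=> j4; have : (d^`(4))`_(j - 4) = 0 by rewrite derivnB P4 subrr coef0.
    rewrite coef_derivn subnKC// => /eqP; rewrite mulrn_eq0 => /orP[|/eqP//].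
    by rewrite -leqn0 leqNgt ffact_gt0 j4.
  have d_low j : (j < 3)%N -> d`_j = 0 by move=> j3; rewrite coefB low// subrr.
  have d3 : d^`(3) = (6 * d`_3)%:P.
    apply/polyP => -[|j]; rewrite coef_derivn coefC.
      by rewrite mulr_natl.
    by rewrite d_high ?mul0rn.
  have : d^`(3).[1] = 0 by rewrite derivnB hornerD hornerN shear wpoly_shear subr0.
  rewrite d3 hornerC => /eqP; rewrite mulf_eq0 pnatr_eq0 /= => /eqP d3_0.
  apply/subr0_eq/polyP => j; rewrite coef0 -/d.
  by case: (ltngtP j 3) => [/d_low|/d_high|->].
by elim=> [|k IH]; apply: base; rewrite ?P0 ?wpoly0_pde// PS IH wpolyS_pde.
Qed.

Lemma formal_diff_param_poly (alpha : nat -> R -> R) beta (P : nat -> {poly R}) :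
  (forall k, {in `[0, 1], forall x, alpha k x = (P k).[x]}) ->
  formal_diff_param alpha beta <->
  [/\ (P 0)^`(4) = 0, forall k, (P k.+1)^`(4) = - P k,
      forall k, (P k)`_0 = 0 /\ (P k)`_1 = 0,
      forall k, (P k)^`(2).[1] = beta k & forall k, (P k)^`(3).[1] = 0].
Proof.
move=> aP.
have i0 : (0 : R) \in `[0, 1] by rewrite in_itv /= lexx ler01.
have i1 : (1 : R) \in `[0, 1] by rewrite in_itv /= lexx ler01.
have D n k := D01n_poly R _ _ n (aP k).
have coef1 k : (P k)^`(1).[0] = (P k)`_1 by rewrite horner_coef0 coef_derivn.
split=> [[_ pde0 pdeS cl sl inp sh]|[pde0 pdeS cl inp sh]].
  split=> [|k|k|k|k].
  - by apply: poly_eq01 => x x01; rewrite -D// pde0// horner0.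
  - by apply: poly_eq01 => x x01; rewrite -D// pdeS// hornerN aP.
  - by rewrite -horner_coef0 -coef1 -aP// -D// cl sl.
  - by rewrite -D.
  - by rewrite -D.
split=> [k|z z01|k z z01|k|k|k|k].
- exact: derivable01n_poly (aP k).
- by rewrite D// pde0 horner0.
- by rewrite D// pdeS hornerN aP.
- by rewrite aP// horner_coef0 (cl k).1.
- by rewrite D// coef1 (cl k).2.
- by rewrite D.
- by rewrite D.
Qed.

End Beam.

Theorem mainTheorem4 (R : realType) (eta mu : nat -> R)
  (eta0 : eta 0%N = 0)
  (etaS : forall k : nat, (0 < k)%N ->
     eta k = - ((-1) ^+ k / (3 * ((4 * k - 1)`!)%:R))
             - \sum_(1 <= i < k.+1) eta (k - i)%N * ((-1) ^+ i / ((4 * i)`!)%:R))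
  (mu0 : mu 0%N = 2)
  (muS : forall k : nat, (0 < k)%N ->
     mu k = 4 ^+ k / ((4 * k)`!)%:R
            - \sum_(1 <= i < k.+1) mu (k - i)%N * ((-1) ^+ i / ((4 * i)`!)%:R)) :
  (exists (alpha : nat -> R -> R) (beta : nat -> R),
     formal_diff_param alpha beta /\ has_z2_coefs alpha (fun k => if k == 0%N then 1 / 2 else 0)) /\
  (forall (alpha : nat -> R -> R) (beta : nat -> R),
     formal_diff_param alpha beta -> has_z2_coefs alpha (fun k => if k == 0%N then 1 / 2 else 0) ->
     [/\ output_is_clamped_moment alpha,
         forall (k : nat) (z : R), z \in `[0, 1] ->
           alpha k z =
             (-1) ^+ k * (1 / ((4 * k + 2)`!)%:R) * z ^+ (4 * k + 2)
             + \sum_(0 <= i < k) (-1) ^+ i * (3 / ((4 * i + 3)`!)%:R)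
                                  * eta (k - i)%N * z ^+ (4 * i + 3)
       & forall k : nat, beta k = 1 / 2 * mu k]).
Proof.
have input := wpoly_input R eta mu eta0 etaS mu0 muS.
have shear := wpoly_shear R eta eta0 etaS.
split.
  exists (fun k => horner (wpoly R eta k)), (fun k => 1 / 2 * mu k); split.
    apply/(formal_diff_param_poly R _ _ (wpoly R eta)) => //; split=> //.
    - exact: wpoly0_pde.
    - exact: wpolyS_pde.
    - by move=> k; rewrite !wpoly_low// andbF.
  (* Among the even powers only the top one, z^(4k+2), occurs; for k = 0 it is the z^2 term, with
     coefficient 1/2. *)
  exists (fun k i => if i == k then (-1) ^+ k / (4 * k + 2)`!%:R else 0),
         (fun k i => (-1) ^+ i * (3 / (4 * i + 3)`!%:R) * eta (k - i)%N).
  split=> [k|k z _|[|k]//].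
  - by rewrite subnn eta0 mulr0.
  - rewrite /wpoly hornerD horner_sum hornerZ horner_monof big_split /=.
    congr (_ + _); last first.
      by apply: eq_bigr => i _; rewrite hornerZ horner_monof; ring.
    rewrite big_ord_recr /= eqxx big1 ?add0r => [|i _]; first by ring.
    by rewrite ltn_eqF ?mul0r.
move=> alpha beta + [c [d [dkk acd c0]]].
pose P k : {poly R} :=
  \sum_(i < k.+1) (c k i *: 'X^(4 * i + 2) + d k i *: 'X^(4 * i + 3)).
have aP k : {in `[0, 1], forall x, alpha k x = (P k).[x]}.
  move=> x x01; rewrite acd// horner_sum; apply: eq_bigr => i _.
  by rewrite hornerD !hornerZ !hornerXn.
move=> /(formal_diff_param_poly R _ _ _ aP)[pde0 pdeS cl inp sh].
have P2 k : (P k)`_2 = c k 0%N.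
  rewrite coef_sum big_ord_recl /= big1 => [|i _].
    by rewrite coefD !coefZ !coefXn /= mulr1 mulr0 !addr0.
  rewrite coefD !coefZ !coefXn /bump /= add1n.
  have [-> ->] : (2 == 4 * i.+1 + 2)%N = false /\ (2 == 4 * i.+1 + 3)%N = false by lia.
  by rewrite !mulr0 addr0.
have Pw : P =1 wpoly R eta.
  apply: wpoly_unique => // k [|[|[|//]]] _; rewrite wpoly_low//= ?andbF ?andbT.
  - exact: (cl k).1.
  - exact: (cl k).2.
  - by rewrite P2 c0.
split=> [|k z z01|k].
- have i0 : (0 : R) \in `[0, 1] by rewrite in_itv /= lexx ler01.
  (* The second derivative at 0 is 2 c_{k,0}, which turns 1/2 into 1. *)
  have moment k : D01n 2 (alpha k) 0 = if k == 0%N then 1 else 0.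
    rewrite (D01n_poly R _ _ 2 (aP k))// horner_coef0 coef_derivn P2 c0.
    rewrite (_ : (2 + 0) ^_ 2 = 2)%N//.
    by case: eqP => _; rewrite ?mul0rn//; field.
  by split=> [|k k0]; rewrite moment// gtn_eqF.
- by rewrite aP// Pw horner_wpoly.
- by rewrite -inp Pw input.
Qed.
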